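(* Let $(a_n)_{n\ge 1}$ be a decreasing sequence of positive real numbers such that $\sum_n a_n$ converges, $a_n>r_n$ for infinitely many $n$, $a_n<r_n$ for infinitely many $n$, and $a_1<r_1$, where $r_n=\sum_{i=n+1}^\infty a_i$. Let $(k_n)$, $(m_n)$, $K$, $\delta_i$ be associated with $(a_n)$ as in the context. If the Star Procedure (described in the context) applied to $(a_n)$ never breaks, that is, for every $n\in\mathbb{N}$ the finite sequence of positive numbers $(M^n_i)_i$ can be defined by it, then the achievement set $E(a_n)=\{\sum_{n\in A}a_n : A\subset\mathbb{N}\}$ is a Cantorval.
   Context: Conventions: $\mathbb{N}=\{1,2,3,\dots\}$; ''decreasing'' means strictly decreasing; a sum $\sum_{i=k}^{m}$ with $m<k$ equals $0$; a condition quantified over the empty set holds vacuously. Cantorval: a compact and perfect set $D\subset\mathbb{R}$ is a Cantorval if each endpoint of every gap of $D$ (a gap is a component of $\mathbb{R}\setminus D$) is an accumulation point of other gaps of $D$ as well as of nontrivial components of $D$ (components that are not single points). Indices. Define inductively $k_1=\min\{i\in\mathbb{N}: a_i>r_i\}$, $m_1=\min\{i\in\mathbb{N}: a_{k_1+i}\le r_{k_1+i}\}$, and, given $k_n,m_n$, $k_{n+1}=\min\{i>k_n+m_n : a_i>r_i\}$, $m_{n+1}=\min\{i\in\mathbb{N}: a_{k_{n+1}+i}\le r_{k_{n+1}+i}\}$. Put $K_n=\{k_n,\dots,k_n+m_n-1\}$ and $K=\bigcup_{n=1}^\infty K_n$ (so $K=\{i: a_i>r_i\}$). For $i\notin K$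 let $\delta_i=r_i-a_i$. Star Procedure. The procedure tries to construct, for $n=1,2,\dots$, finite (possibly empty) sequences $(M^n_i)_i$ of positive numbers. Initial step: $(M^1_i)_i$ consists of the numbers $M^1_i=\delta_i$ for $1\le i<k_1-1$. Inductive step: suppose $(M^n_i)_i$ has been defined. For a number $M=M^n_i$ of this sequence consider the conditions $( * )$: $M-a_{k_n}>0$; and $r_{k_n}+r_{k_n+m_n-1}-M>0$; and for all $j\in\{1,\dots,m_n-1\}$, $M-2a_{k_n+j}-\sum_{l=1}^{j-1}a_{k_n+l}>0$. $( ** )$: $M-2a_{k_n}>0$. Consider also the condition (on $\delta_{k_n-1}$) $( *')$: $\delta_{k_n-1}-\sum_{j=1}^{m_n-1}a_{k_n+j}>0$; and for all $j\in\{1,\dots,m_n-1\}$, $2r_{k_n+j}-\delta_{k_n-1}+\sum_{i=1}^{j-1}a_{k_n+i}>0$. If every number $M^n_i$ satisfies $( * )$ or $( ** )$, and moreover $( *')$ holds, then the procedure continues and $(M^{n+1}_i)_i$ is defined as the finite sequence consisting of: for each $M^n_i$, the left-hand sides of all the inequalities in whichever of the conditions $( * )$, $( ** )$ it satisfies (the two conditions are mutually exclusive, since $r_{k_n}+r_{k_n+m_n-1}<2a_{k_n}$); the left-hand sides of all inequalities in $( *')$; and all numbers $\delta_i$ with $k_n+m_n\le i<k_{n+1}-1$. Otherwise the procedure breaks. *)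

(* Defs.v *)
From HB Require Import structures.
From mathcomp Require Import all_boot all_order all_algebra.
From mathcomp Require Import all_classical all_reals all_analysis.
Set Implicit Arguments.
Unset Strict Implicit.
Unset Printing Implicit Defensive.
Import Order.TTheory GRing.Theory Num.Theory.
Import numFieldNormedType.Exports.
Local Open Scope classical_set_scope.
Local Open Scope ring_scope.

Definition components {T : topologicalType} (A : set T) : set (set T) :=
  [set connected_component A x | x in A].

(* The unbounded components of the complement are gaps too. *)
Definition gaps {R : realType} (D : set R) : set (set R) := components (~` D).

Definition nontrivial_components {R : realType} (D : set R) : set (set R) :=
  [set C | components D C /\ forall x, C <> [set x]].

(* Meant for nonempty intervals I; an unbounded side gives no endpoint. *)
Definition is_endpoint {R : realType} (x : R) (I : set R) : Prop :=
  (has_lbound I /\ x = inf I) \/ (has_ubound I /\ x = sup I).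

(* A whole member of F is asked for inside each neighborhood of x. As used in
   Cantorval (for perfect D, with both conditions), this is equivalent to asking
   that each neighborhood meet a member of F, or infinitely many of them. *)
Definition accumulation_point {R : realType} (F : set (set R)) (x : R) : Prop :=
  forall U, nbhs x U -> exists2 C, F C & C `<=` U.

Definition Cantorval {R : realType} (D : set R) : Prop :=
  [/\ compact D, perfect_set D &
      forall G x, gaps D G -> is_endpoint x G ->
        accumulation_point (gaps D `\ G) x /\
        accumulation_point (nontrivial_components D) x].

(* Sequences are indexed from 1: the value a 0 never matters. *)

Definition remainder {R : realType} (a : nat -> R) (n : nat) : R :=
  \big[+%R/0]_(n.+1 <= i <oo) a i.

Definition achievement_set {R : realType} (a : nat -> R) : set R :=
  [set \big[+%R/0]_(1 <= i <oo | i \in A) a i | A in [set: set nat]].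

(* The minimum of a set of natural numbers (0 for the empty set). *)
Definition min_nat (P : set nat) : nat :=
  xget 0%N [set i | P i /\ forall j, P j -> (i <= j)%N].

(* The pair (k_n, m_n) for n >= 1; the dummy value (0, 0) at n = 0 makes
   k_1 = min {i > 0 : a_i > r_i} an instance of the general recursion. *)
Fixpoint block {R : realType} (a : nat -> R) (n : nat) : nat * nat :=
  if n is p.+1 then
    let: (k, m) := block a p in
    let k' := min_nat [set i | (k + m < i)%N /\ remainder a i < a i] in
    (k', min_nat [set i | (0 < i)%N /\ a (k' + i)%N <= remainder a (k' + i)])
  else (0%N, 0%N).

Definition idx_k {R : realType} (a : nat -> R) (n : nat) : nat := (block a n).1.
Definition idx_m {R : realType} (a : nat -> R) (n : nat) : nat := (block a n).2.

Section StarProcedure.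
Context {R : realType} (a : nat -> R).

Local Notation r := (remainder a).

(* Only used at indices i >= 1 with a_i <= r_i. *)
Definition delta (i : nat) : R := r i - a i.

Definition positive (s : seq R) : bool := all (fun x => 0 < x) s.

(* The left-hand sides of the inequalities in the conditions ( * ), ( ** ) and
   ( *' ), where k = k_n and m = m_n; each condition says that all of its
   left-hand sides are positive. *)
Definition lhs_star (k m : nat) (M : R) : seq R :=
  [:: M - a k, r k + r (k + m).-1 - M &
      [seq M - 2 * a (k + j)%N - \sum_(1 <= l < j) a (k + l)%N
         | j <- index_iota 1 m]].

Definition lhs_star2 (k : nat) (M : R) : seq R := [:: M - 2 * a k].

Definition lhs_star' (k m : nat) : seq R :=
  delta k.-1 - \sum_(1 <= j < m) a (k + j)%N ::
  [seq 2 * r (k + j)%N - delta k.-1 + \sum_(1 <= i < j) a (k + i)%N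
     | j <- index_iota 1 m].

Definition star_continues (k m : nat) (s : seq R) : bool :=
  all (fun M => positive (lhs_star k m M) || positive (lhs_star2 k M)) s
  && positive (lhs_star' k m).

Definition star_successors (k m : nat) (M : R) : seq R :=
  (if positive (lhs_star k m M) then lhs_star k m M else [::]) ++
  (if positive (lhs_star2 k M) then lhs_star2 k M else [::]).

(* star_sequence n s: the procedure reaches stage n >= 1, with (M^n_i)_i = s.
   Positivity of the entries need not be imposed: when an entry is not
   positive, neither ( * ) nor ( ** ) holds for it, and the procedure breaks. *)
Inductive star_sequence : nat -> seq R -> Prop :=
| star_init :
    star_sequence 1 [seq delta i | i <- index_iota 1 (idx_k a 1).-1]
| star_step (n : nat) (s : seq R) :
    star_sequence n s ->
    star_continues (idx_k a n) (idx_m a n) s ->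
    star_sequence n.+1
      (flatten [seq star_successors (idx_k a n) (idx_m a n) M | M <- s]
       ++ lhs_star' (idx_k a n) (idx_m a n)
       ++ [seq delta i
             | i <- index_iota (idx_k a n + idx_m a n) (idx_k a n.+1).-1]).

Definition star_never_breaks : Prop :=
  forall n, (0 < n)%N -> exists s, star_sequence n s.

End StarProcedure.

(* Main.v *)
(** Cut the intervals [z, z + r_n], with z a sum of some of a_1, ..., a_n, one
    index at a time, starting from [0, r_0]. Two neighbouring intervals obtained
    by cutting at an index i outside K overlap in a segment of length delta_i,
    and this overlap persists between their adjacent descendants. The numbers
    M^n_i are the overlaps along a chain of such intervals: inside a block K_n
    gaps open, but the conditions of the Star Procedure guarantee that the
    descendants of neighbours can be rearranged into a chain again. A block
    shortens the chain by only a_{k_n} at each end, and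
    2 (a_{k_1} + a_{k_2} + ...) < r_0 since a_{k_n} < a_{k_n - 1}. By
    compactness the achievement set E contains a nondegenerate interval.

    Then every tail {sums over indices > k} contains an interval, and
    (r_k, a_k) is a gap for k in K, so that near 0 there are arbitrarily small
    gaps and interval components. The right endpoint d of a gap is a finite sum,
    and E near d looks like E near 0; the symmetry E = r_0 - E handles the left
    endpoints. *)
Require Import Defs.
From HB Require Import structures.
From mathcomp Require Import all_boot all_order all_algebra.
From mathcomp Require Import all_classical all_reals all_analysis.
From mathcomp Require Import zify ring lra.
Import Order.TTheory GRing.Theory Num.Theory.
Import numFieldNormedType.Exports.
Local Open Scope classical_set_scope.
Local Open Scope ring_scope.
Set Implicit Arguments.
Unset Strict Implicit.

(** * Subsums and remainders of a positive summable series *)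

(** Index sets are encoded as boolean sequences, that is, points of the Cantor space, whose
    compactness is used below. The value [b 0] never counts. *)
Definition subsum {R : realType} (a : nat -> R) (b : nat -> bool) : R :=
  \big[+%R/0]_(1 <= i <oo | b i) a i.

Definition fsubsum {R : realType} (a : nat -> R) (n : nat) (b : nat -> bool) : R :=
  \sum_(1 <= i < n.+1 | b i) a i.

Section SubSums.
Context {R : realType} (a : nat -> R).
Context (a_pos : forall n, (1 <= n)%N -> 0 < a n).
Context (a_summable : cvgn (fun n => \sum_(1 <= i < n) a i)).

Local Notation r := (remainder a).
Local Notation E := (achievement_set a).

Lemma achievement_setE : E = range (subsum a).
Proof.
apply/seteqP; split=> x /=.
  by case=> A _ <-; exists (fun i => i \in A).
case=> b _ <-; exists [set i | b i] => //.
rewrite /subsum; congr (limn _); apply: funext => n.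
apply: eq_bigl => i; apply/idP/idP; first by move/set_mem.
by move=> bi; apply/mem_set.
Qed.

Lemma partial_subsum_homo (b : nat -> bool) :
  {homo (fun n => \sum_(1 <= i < n | b i) a i) : n m / (n <= m)%N >-> n <= m}.
Proof.
apply/nondecreasing_seqP => -[|n]; first by rewrite !big_geq.
rewrite [leRHS]big_mkcond big_nat_recr //= -big_mkcond /=.
by case: ifP => // _; rewrite ?addr0 // lerDl ltW // a_pos.
Qed.

Lemma cvg_partial_subsum (b : nat -> bool) :
  cvgn (fun n => \sum_(1 <= i < n | b i) a i).
Proof.
apply: nondecreasing_is_cvgn; first exact: partial_subsum_homo.
exists (limn (fun n => \sum_(1 <= i < n) a i)) => _ [n _ <-].
apply: le_trans (nondecreasing_cvgn_le (partial_subsum_homo xpredT) a_summable n).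
rewrite big_mkcond ler_sum_nat // => i /andP[i1 _].
by case: ifP => // _; rewrite ltW // a_pos.
Qed.

Lemma fsubsum_le_subsum n (b : nat -> bool) : fsubsum a n b <= subsum a b.
Proof.
exact: (nondecreasing_cvgn_le (@partial_subsum_homo b) (@cvg_partial_subsum b) n.+1).
Qed.

Lemma subsum_ge0 (b : nat -> bool) : 0 <= subsum a b.
Proof. by apply: le_trans (fsubsum_le_subsum 0 b); rewrite /fsubsum big_geq. Qed.

Lemma eq_subsum (b c : nat -> bool) : (forall i, (0 < i)%N -> b i = c i) ->
  subsum a b = subsum a c.
Proof.
move=> bc; congr (limn _); apply: funext => n.
by apply: congr_big_nat => // i /andP[/bc].
Qed.

Lemma eq_fsubsum n (b c : nat -> bool) :
  (forall i, (0 < i <= n)%N -> b i = c i) -> fsubsum a n b = fsubsum a n c.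
Proof. by move=> bc; apply: congr_big_nat => // i /bc. Qed.

Lemma subsumID (c b : nat -> bool) :
  subsum a b = subsum a (fun i => b i && c i) + subsum a (fun i => b i && ~~ c i).
Proof.
rewrite /subsum -limD; try exact: cvg_partial_subsum.
by congr (limn _); apply: funext => n; rewrite (bigID c) /=.
Qed.

Lemma fsubsumS n (b : nat -> bool) :
  fsubsum a n.+1 b = fsubsum a n b + (if b n.+1 then a n.+1 else 0).
Proof. by rewrite /fsubsum [LHS]big_mkcond big_nat_recr //= -big_mkcond. Qed.

Lemma subsum_fin n (b : nat -> bool) : (forall i, (n < i)%N -> b i = false) ->
  subsum a b = fsubsum a n b.
Proof.
move=> bn; apply: lim_near_cst; first exact: Rhausdorff.
exists n.+1 => // N /= nN; rewrite (big_cat_nat (n := n.+1)) //=.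
rewrite [X in _ + X]big_nat_cond [X in _ + X]big_pred0 ?addr0 // => i.
by apply/negP => /andP[/andP[/bn ->]].
Qed.

Lemma remainderE n : r n = subsum a (fun i => n < i)%N.
Proof.
congr (limn _); apply: funext => N.
by rewrite (big_nat_widenl _ 1%N).
Qed.

Lemma subsum_split n (b : nat -> bool) :
  subsum a b = fsubsum a n b + subsum a (fun i => b i && (n < i)%N).
Proof.
rewrite (subsumID (fun i => i <= n)%N) (@subsum_fin n); last first.
  by move=> i ni /=; rewrite leqNgt ni andbF.
congr (_ + _); first by apply: eq_fsubsum => i /andP[_ ni] /=; rewrite ni andbT.
by apply: eq_subsum => i _ /=; rewrite -ltnNge andbC.
Qed.

Lemma subsum_mono (b c : nat -> bool) : (forall i, (0 < i)%N -> b i -> c i) ->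
  subsum a b <= subsum a c.
Proof.
move=> bc; rewrite (subsumID b c) (@eq_subsum _ (fun i => c i && b i)) ?lerDl ?subsum_ge0 //.
by move=> i i0 /=; case: (b i) (bc i i0) => [->|] //; rewrite andbF.
Qed.

Lemma tail_le_remainder n (b : nat -> bool) :
  subsum a (fun i => b i && (n < i)%N) <= r n.
Proof. by rewrite remainderE; apply: subsum_mono => i _ /andP[]. Qed.

Lemma remainder0 : r 0 = subsum a xpredT.
Proof. by rewrite remainderE; apply: eq_subsum => i ->. Qed.

Lemma remainder_split n : r 0 = fsubsum a n xpredT + r n.
Proof. by rewrite remainder0 (subsum_split n) remainderE. Qed.

Lemma remainderS n : r n = a n.+1 + r n.+1.
Proof.
have := remainder_split n.+1; rewrite (remainder_split n) fsubsumS -addrA.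
by move/addrI.
Qed.

Lemma remainder_ge0 n : 0 <= r n.
Proof. by rewrite remainderE subsum_ge0. Qed.

Lemma le_remainder m n : (m <= n)%N -> r n <= r m.
Proof.
move=> mn; rewrite !remainderE; apply: subsum_mono => i _.
exact: leq_ltn_trans.
Qed.

Lemma term_le_remainder m n : (m < n)%N -> a n <= r m.
Proof.
case: n => // n; rewrite ltnS => mn; apply: le_trans (le_remainder mn).
by rewrite remainderS lerDl remainder_ge0.
Qed.

Lemma remainder_lt_eps e : 0 < e -> exists n, forall m, (n <= m)%N -> r m < e.
Proof.
move=> e0; have /cvgrPdist_lt/(_ _ e0)[n _ nP] := @cvg_partial_subsum xpredT.
exists n => m nm; have /= := nP m.+1 (leq_trans nm (leqnSn m)).
rewrite -/(subsum a xpredT) -remainder0 (remainder_split m) /fsubsum.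
by rewrite [_ + r m]addrC addrK ger0_norm // remainder_ge0.
Qed.

End SubSums.

(** * Splitting the achievement set into finite sums and tails *)

Definition finite_sums {R : realType} (a : nat -> R) (n : nat) : set R :=
  [set fsubsum a n b | b in [set: nat -> bool]].

Definition tail_sums {R : realType} (a : nat -> R) (n : nat) : set R :=
  [set subsum a (fun i => b i && (n < i)%N) | b in [set: nat -> bool]].

Section AchievementSet.
Context {R : realType} (a : nat -> R).
Context (a_pos : forall n, (1 <= n)%N -> 0 < a n).
Context (a_summable : cvgn (fun n => \sum_(1 <= i < n) a i)).

Local Notation r := (remainder a).
Local Notation E := (achievement_set a).
Local Notation F := (finite_sums a).
Local Notation T := (tail_sums a).

Lemma finite_sums0 : F 0%N 0.
Proof. by exists xpredT => //; rewrite /fsubsum big_geq. Qed.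

Lemma finite_sumsS n : F n.+1 = F n `|` [set x + a n.+1 | x in F n].
Proof.
apply/seteqP; split=> x /=.
  case=> b _ <-; rewrite fsubsumS; case: (b _); last by rewrite addr0; left; exists b.
  by right; exists (fsubsum a n b) => //; exists b.
have eqF (b : nat -> bool) c : fsubsum a n b =
    fsubsum a n (fun i => if i == n.+1 then c else b i).
  by apply: eq_fsubsum => i /andP[_]; rewrite -ltnS ltn_neqAle => /andP[/negPf->].
case=> [[b _ <-]|[_ [b _ <-] <-]].
  exists (fun i => if i == n.+1 then false else b i) => //.
  by rewrite fsubsumS eqxx addr0 -eqF.
exists (fun i => if i == n.+1 then true else b i) => //.
by rewrite fsubsumS eqxx -eqF.
Qed.

Lemma finite_sums_skip n x : F n x -> F n.+1 x.
Proof. by rewrite finite_sumsS; left. Qed.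

Lemma finite_sums_add n x : F n x -> F n.+1 (x + a n.+1).
Proof. by move=> Fx; rewrite finite_sumsS; right; exists x. Qed.

Lemma finite_sums_widen m n x : (m <= n)%N -> F m x -> F n x.
Proof.
elim: n => [|n IH]; first by rewrite leqn0 => /eqP->.
by rewrite leq_eqVlt => /predU1P[->//|mn Fx]; apply/finite_sums_skip/IH.
Qed.

(** A consequence of the finiteness of [F n], obtained by induction: a point of [F n.+1] above [d]
    is either a point of [F n] above [d] or the translate by [a n.+1] of a point of [F n] above
    [d - a n.+1]. *)
Lemma finite_sums_isolated n d : exists2 e, 0 < e & forall f, F n f -> d < f -> d + e <= f.
Proof.
elim: n d => [|n IH] d.
  have [d0|d0] := ltP d 0.
    exists (- d); first by rewrite oppr_gt0.
    by move=> _ [b _ <-] _; rewrite /fsubsum big_geq // addrN.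
  exists 1 => // _ [b _ <-]; rewrite /fsubsum big_geq // => /lt_geF; by rewrite d0.
have [e1 e1_gt0 eP1] := IH d; have [e2 e2_gt0 eP2] := IH (d - a n.+1).
exists (Num.min e1 e2); first by rewrite lt_min e1_gt0.
have m1 : Num.min e1 e2 <= e1 by rewrite ge_min lexx.
have m2 : Num.min e1 e2 <= e2 by rewrite ge_min lexx orbT.
move=> f; rewrite finite_sumsS => -[/eP1 h df|[g /eP2 h <-] df].
  by have := h df; lra.
have /h : d - a n.+1 < g by lra.
lra.
Qed.

Lemma tail_sums0 n : T n 0.
Proof.
exists (fun=> false) => //; rewrite (@subsum_fin _ _ 0) //.
by rewrite /fsubsum big_geq.
Qed.

Lemma tail_sums_ge0 n x : T n x -> 0 <= x.
Proof. by case=> b _ <-; exact: subsum_ge0. Qed.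

Lemma tail_sums_le n x : T n x -> x <= r n.
Proof. by case=> b _ <-; exact: tail_le_remainder. Qed.

Lemma tail_sums_remainder n : T n (r n).
Proof. by exists xpredT; rewrite // remainderE. Qed.

Lemma achievement_setD n x y : F n x -> T n y -> E (x + y).
Proof.
case=> b _ <- [c _ <-]; rewrite achievement_setE.
exists (fun i => if (i <= n)%N then b i else c i) => //.
rewrite (subsum_split a_pos a_summable n); congr (_ + _).
  by apply: eq_fsubsum => i /andP[_ ->].
by apply: eq_subsum => i _; case: ltnP; rewrite ?andbF.
Qed.

Lemma achievement_set_decomp n x : E x ->
  exists y z, [/\ F n y, T n z & x = y + z].
Proof.
rewrite achievement_setE => -[b _ <-].
exists (fsubsum a n b), (subsum a (fun i => b i && (n < i)%N)).
by split; [exists b | exists b | exact: subsum_split].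
Qed.

Lemma finite_sums_sub n x : F n x -> E x.
Proof.
by move=> Fx; rewrite -[x]addr0; apply: (achievement_setD Fx); exact: tail_sums0.
Qed.

Lemma tail_sums_sub n x : T n x -> E x.
Proof.
move=> Tx; rewrite -[x]add0r; apply: achievement_setD (Tx).
exact: finite_sums_widen (leq0n n) finite_sums0.
Qed.

Lemma tail_sumsS n x : T n x -> T n.+1 x \/ T n.+1 (x - a n.+1).
Proof.
have split1 (b : nat -> bool) : subsum a (fun i => b i && (n < i)%N) =
    (if b n.+1 then a n.+1 else 0) + subsum a (fun i => b i && (n.+1 < i)%N).
  rewrite (subsum_split a_pos a_summable n.+1) fsubsumS ltnSn andbT.
  congr (_ + _); last first.
    by apply: eq_subsum => i _; case: (ltnP n.+1 i) => [/ltnW->|]; rewrite ?andbT ?andbF.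
  rewrite /fsubsum big_nat_cond big_pred0 ?add0r // => i.
  by apply/negP => /andP[/andP[_]]; rewrite ltnS leqNgt => /negPf->; rewrite andbF.
case=> b _ <-; rewrite split1; case: (b n.+1); last first.
  by rewrite add0r; left; exists b.
by rewrite addrAC subrr add0r; right; exists b.
Qed.

Lemma achievement_set_sym x : E x -> E (r 0%N - x).
Proof.
rewrite achievement_setE => -[b _ <-]; exists (fun i => ~~ b i) => //.
rewrite remainder0 (subsumID a_pos a_summable b xpredT) /=.
by rewrite [_ + subsum _ _]addrC addrK.
Qed.

Lemma achievement_set_ge0 x : E x -> 0 <= x.
Proof. by rewrite achievement_setE => -[b _ <-]; exact: subsum_ge0. Qed.


(** * Compactness of the tails, and intervals inside them *)

Lemma near_cantor_agree (b : cantor_space) m :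
  \forall c \near b, forall i, (i <= m)%N -> c i = b i.
Proof.
have near1 i : \forall c \near b, c i = b i.
  apply: (@proj_continuous nat (fun=> bool) i b [set x | x = b i]).
  by rewrite nbhs_principalE; exact/principal_filterP.
elim: m => [|m IH].
  by near=> c => i; rewrite leqn0 => /eqP->; near: c; exact: near1.
near=> c => i; rewrite leq_eqVlt => /predU1P[->|]; first by near: c; exact: near1.
by move: i; near: c; exact: IH.
Unshelve. all: by end_near. Qed.

(** Sequences that agree up to index [m] have sums differing by at most [r m]. *)
Lemma continuous_tail_subsum n :
  continuous (fun b : cantor_space => subsum a (fun i => b i && (n < i)%N)).
Proof.
move=> b; apply/cvgrPdist_lt => e e_gt0.
have [m /(_ _ (leqnn m)) rm] := remainder_lt_eps a_pos a_summable e_gt0.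
have := near_cantor_agree b m; apply: filterS => c cb.
apply: le_lt_trans rm; rewrite !(subsum_split a_pos a_summable m (fun i => _ i && _)).
rewrite (@eq_fsubsum _ _ _ (fun i => c i && _) (fun i => b i && (n < i)%N)); last first.
  by move=> i /andP[_ im]; rewrite cb.
rewrite opprD addrACA subrr add0r ler_norml.
have := tail_le_remainder a_pos a_summable m (fun i => b i && (n < i)%N).
have := tail_le_remainder a_pos a_summable m (fun i => c i && (n < i)%N).
have := subsum_ge0 a_pos a_summable (fun i => b i && (n < i) && (m < i))%N.
have := subsum_ge0 a_pos a_summable (fun i => c i && (n < i) && (m < i))%N.
lra.
Qed.

Lemma tail_sums_compact n : compact (T n).
Proof.
apply: (@continuous_compact cantor_space); last exact: cantor_space_compact.
by apply: continuous_subspaceT; exact: continuous_tail_subsum.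
Qed.

Lemma achievement_set_tail : E = T 0%N.
Proof.
rewrite achievement_setE; apply/seteqP; split=> _ [b _ <-]; exists b => //.
  by apply: eq_subsum => i ->; rewrite andbT.
by apply: eq_subsum => i ->; rewrite andbT.
Qed.

Lemma tail_sums_closed n : closed (T n).
Proof. by apply: compact_closed; [exact: Rhausdorff | exact: tail_sums_compact]. Qed.

Lemma tail_sums_interval n (p q : R) : p < q -> `[p, q] `<=` E ->
  exists p' q' : R, p' < q' /\ `[p', q'] `<=` T n.
Proof.
move=> pq; rewrite achievement_set_tail => sub0; elim: n => [|n [p' [q' [{}pq sub]]]].
  by exists p, q.
have [sub'|] := pselect (`[p', q'] `<=` T n.+1); first by exists p', q'.
move=> /existsNP[x /not_implyP[/= xpq Tx]].
have /open_nbhs_nbhs : open_nbhs x (~` T n.+1) by split => //; exact/closed_openC/tail_sums_closed.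
move=> /nbhs_ballP[e /= e0 eP].
pose p1 := Num.max p' (x - e / 2); pose q1 := Num.min q' (x + e / 2).
exists (p1 - a n.+1), (q1 - a n.+1); split.
  rewrite ltrD2r /p1 /q1 gt_max !lt_min pq /=.
  by move: xpq; rewrite in_itv /= => /andP[? ?]; apply/and3P; split; lra.
move=> y; rewrite /= in_itv /= lerBlDr lerBrDr ge_max le_min.
move=> /andP[/andP[y1 y2] /andP[y3 y4]].
have /sub/tail_sumsS[] : (y + a n.+1) \in `[p', q'] by rewrite in_itv /= y1.
  move=> Ty; exfalso; apply: eP Ty.
  by rewrite /ball /= ltr_norml; apply/andP; split; lra.
by rewrite addrK.
Qed.

(** * Intervals and gaps near the endpoints of gaps; perfectness *)

Context (a_decr : forall i j, (1 <= i)%N -> (i < j)%N -> a j < a i).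

Lemma finite_sums_ge n x : F n x -> x = 0 \/ a n <= x.
Proof.
case: n => [[b _ <-]|n]; first by left; rewrite /fsubsum big_geq.
elim: n x => [|n IH] x; rewrite finite_sumsS => -[Fx|[y Fy <-]].
- by left; case: Fx => b _ <-; rewrite /fsubsum big_geq.
- by right; rewrite lerDr achievement_set_ge0 //; exact: finite_sums_sub Fy.
- case: (IH _ Fx) => [|ax]; [by left | right].
  by apply: le_trans ax; rewrite ltW // a_decr.
- by right; rewrite lerDr achievement_set_ge0 //; exact: finite_sums_sub Fy.
Qed.

(** A point with a nonzero digit up to [k] is at least [a k], the least of these terms. As [T k] is
    bounded by [r k], no point of [E] lies strictly between [r k] and [a k]. *)
Lemma achievement_set_ge k x : E x -> T k x \/ a k <= x.
Proof.
move=> /(@achievement_set_decomp k)[y [z [/finite_sums_ge[->|ay] Tz ->]]].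
  by rewrite add0r; left.
by right; rewrite (le_trans ay) // lerDl (tail_sums_ge0 Tz).
Qed.

(** The right end [d] of a gap is a finite sum, so [E] contains [d + T k] for large [k]. This copy
    contains an interval, and for [k] in K it is followed by the gap from [d + r k] to [d + a k]. *)
Lemma near_gap_sup (c d e p q : R) :
    infinite_set [set n | (1 <= n)%N /\ r n < a n] ->
    p < q -> `[p, q] `<=` E ->
    c < d -> E d -> (forall x, c < x < d -> ~ E x) -> 0 < e ->
  exists z w u v : R, [/\ d <= z, z < w, w <= u, u < v & v < d + e] /\
    [/\ `[z, w] `<=` E, E u, E v & forall x, u < x < v -> ~ E x].
Proof.
move=> infK pq pqE cd Ed cdE e_gt0.
have dc_gt0 : 0 < d - c by rewrite subr_gt0.
have [n /(_ _ (leqnn n)) rn] := remainder_lt_eps a_pos a_summable dc_gt0.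
(* If [f] were less than [d], then [r n < d - c] would place it strictly between [c] and [d]. *)
have F_le_d f : F n f -> f <= d -> d <= f + r n -> f = d.
  move=> /finite_sums_sub Ef; rewrite le_eqVlt => /predU1P[//|fd] dfr.
  by case: (cdE f _ Ef); rewrite fd andbT; lra.
have Fd : F n d.
  have [y [z [Fy Tz dE]]] := @achievement_set_decomp n d Ed.
  have z0 := tail_sums_ge0 Tz; have zr := tail_sums_le Tz.
  by rewrite -(F_le_d y Fy) // dE; lra.
have [e1 e1_gt0 e1P] := finite_sums_isolated n d.
have min_gt0 : 0 < Num.min e e1 by rewrite lt_min e_gt0.
have [N NP] := remainder_lt_eps a_pos a_summable min_gt0.
(* Taking [k] beyond [N] makes [a k] smaller than [e] and than the distance [e1] from [d] to larger
   points of [F n]. *)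
have [k] : exists2 k, (maxn n N < k)%N & r k < a k.
  apply: contra_notP infK => nk; apply: (sub_finite_set _ (finite_II (maxn n N).+1)).
  move=> k /= [_ rk]; rewrite ltnS leqNgt; apply/negP => nNk.
  by apply: nk; exists k.
rewrite gtn_max => /andP[nk Nk] rk.
have ak : a k < Num.min e e1.
  exact: le_lt_trans (term_le_remainder a_pos a_summable Nk) (NP _ (leqnn N)).
move: ak; rewrite lt_min => /andP[ake ake1].
have [p' [q' [pq' sub]]] := @tail_sums_interval k p q pq pqE.
have Tin x : p' <= x <= q' -> T k x by move=> h; apply: sub; rewrite /= in_itv.
have p'0 : 0 <= p' by apply: (@tail_sums_ge0 k); apply: Tin; lra.
have q'r : q' <= r k by apply: (@tail_sums_le k); apply: Tin; lra.
have Fkd : F k d := finite_sums_widen (ltnW nk) Fd.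
exists (d + p'), (d + q'), (d + r k), (d + a k); split; first by split; lra.
split.
- move=> x; rewrite /= in_itv /= => /andP[px xq].
  rewrite -[x](subrK d) addrC; apply: achievement_setD Fkd _.
  by apply: Tin; lra.
- by apply: achievement_setD Fkd _; exact: tail_sums_remainder.
- case: k nk {Nk rk ake ake1 pq' sub Tin p'0 q'r Fkd} => // k nk.
  apply: (@finite_sums_sub k.+1); apply: finite_sums_add.
  by apply: finite_sums_widen Fd; rewrite -ltnS.
(* The finite part [y] must be [d]: a larger one is at least [d + e1], beyond [d + a k]. Then [z]
   would fall between [r k] and [a k]. *)
- move=> x /andP[x1 x2] /(@achievement_set_decomp n)[y [z [Fy Tz xE]]].
  have z0 := tail_sums_ge0 Tz; have zr := tail_sums_le Tz.
  have yd : y = d.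
    have rk0 := remainder_ge0 a_pos a_summable k.
    have [/(e1P _ Fy)|yd] := ltP d y; first by lra.
    by apply: F_le_d => //; lra.
  have [/tail_sums_le|] := @achievement_set_ge k z (tail_sums_sub Tz); lra.
Qed.

(** Mirror image of [near_gap_sup] under the symmetry of [E] about half of [r 0]. *)
Lemma near_gap_inf (c d e p q : R) :
    infinite_set [set n | (1 <= n)%N /\ r n < a n] ->
    p < q -> `[p, q] `<=` E ->
    c < d -> E c -> (forall x, c < x < d -> ~ E x) -> 0 < e ->
  exists z w u v : R, [/\ c - e < v, v < u, u <= w, w < z & z <= c] /\
    [/\ `[w, z] `<=` E, E u, E v & forall x, v < x < u -> ~ E x].
Proof.
move=> infK pq pqE cd Ec cdE e_gt0.
have symE x : E x = E (r 0%N - x).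
  apply/propext; split; first exact: achievement_set_sym.
  by move=> /achievement_set_sym; rewrite opprB addrC subrK.
have [||| z [w [u [v [ineq [zw Eu Ev uv]]]]]] :=
    @near_gap_sup (r 0%N - d) (r 0%N - c) e p q infK pq pqE _ _ _ e_gt0.
- by lra.
- by rewrite -symE.
- by move=> x xcd; rewrite symE; apply: cdE; lra.
exists (r 0%N - z), (r 0%N - w), (r 0%N - u), (r 0%N - v); split.
  by case: ineq => ? ? ? ? ?; split; lra.
rewrite -!symE; split=> // x.
- rewrite /= in_itv /= => xwz; rewrite symE; apply: zw; rewrite /= in_itv /=; lra.
- by move=> xuv; rewrite symE; apply: uv; lra.
Qed.

Lemma achievement_set_perfect : perfect_set E.
Proof.
have clE : closed E by rewrite achievement_set_tail; exact: tail_sums_closed.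
split => //; apply/seteqP; split.
  move=> x lx; rewrite (closure_id E).1 // => U /lx[y [_ Ey Uy]]; by exists y.
move=> x Ex U /nbhs_ballP[e /= e_gt0 eU].
have [n /(_ _ (leqnn n)) rn] := remainder_lt_eps a_pos a_summable e_gt0.
have an : a n.+1 < e.
  exact: le_lt_trans (term_le_remainder a_pos a_summable (ltnSn n)) rn.
have a_gt0 := a_pos (ltn0Sn n).
move: Ex; rewrite achievement_setE => -[b _ bx].
(* Flipping the single digit [n.+1] moves [x] by [a n.+1], which is less than [e]. *)
pose c i := if i == n.+1 then ~~ b i else b i.
have cx : subsum a c = x + (if b n.+1 then - a n.+1 else a n.+1).
  rewrite -bx (subsum_split a_pos a_summable n.+1 c) (subsum_split a_pos a_summable n.+1 b).
  rewrite !fsubsumS {2}/c eqxx.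
  rewrite (@eq_fsubsum _ _ _ c b); last first.
    by move=> i /andP[_]; rewrite /c -ltnS ltn_neqAle => /andP[/negPf->].
  rewrite (@eq_subsum _ _ (fun i => c i && _) (fun i => b i && (n.+1 < i)%N)); last first.
    by move=> i _; rewrite /c ltn_neqAle [n.+1 == i]eq_sym; case: eqP; rewrite ?andbF.
  by case: (b n.+1) => /=; lra.
exists (subsum a c); split; last 2 first.
- by exists c.
- by apply: eU; rewrite /ball /= ltr_norml cx; case: ifP => _; apply/andP; split; lra.
- by rewrite cx; apply/eqP; case: ifP => _; lra.
Qed.

End AchievementSet.

(** * Gaps and components of subsets of the line *)

Section Gaps.
Context {R : realType}.
Implicit Types (D G : set R).

Lemma gap_itv D (u v : R) : D u -> D v -> u < v -> (forall x, u < x < v -> ~ D x) ->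
  gaps D `]u, v[%classic.
Proof.
move=> Du Dv uv uvD; have m1 : u < (u + v) / 2 by lra.
have m2 : (u + v) / 2 < v by lra.
exists ((u + v) / 2); first by apply: uvD; rewrite m1.
apply/seteqP; split=> [x Cx|]; last first.
  apply: connected_component_max.
  - by rewrite /= in_itv /= m1.
  - by move=> x; rewrite /= in_itv; exact: uvD.
  - exact/connected_intervalP/interval_is_interval.
have subC := @connected_component_sub _ (~` D) ((u + v) / 2).
have Cm : connected_component (~` D) ((u + v) / 2) ((u + v) / 2).
  by apply: connected_component_refl; apply: uvD; rewrite m1.
have /connected_intervalP intC := @component_connected _ (~` D) ((u + v) / 2).
rewrite /= in_itv /= !ltNge; apply/andP; split; apply/negP => le.
  by apply: (subC u) Du; apply: intC Cx Cm _ _; rewrite le ltW.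
by apply: (subC v) Dv; apply: intC Cm Cx _ _; rewrite le ltW.
Qed.

(** The component containing [z] and [w] is an interval, so it cannot pass the points [p] and [q]
    outside [D]. *)
Lemma nontrivial_component_within D (p z w q : R) :
    ~ D p -> ~ D q -> p < z -> z < w -> w < q -> `[z, w] `<=` D ->
  exists2 C, nontrivial_components D C & C `<=` `]p, q[%classic.
Proof.
move=> Dp Dq pz zw wq zwD.
have subC := @connected_component_sub _ D z.
have /connected_intervalP intC := @component_connected _ D z.
have zwC : `[z, w] `<=` connected_component D z.
  apply: connected_component_max => //.
    by rewrite /= in_itv /= lexx ltW.
  exact/connected_intervalP/interval_is_interval.
have Cz : connected_component D z z by apply: zwC; rewrite /= in_itv /= lexx ltW.
have Cw : connected_component D z w by apply: zwC; rewrite /= in_itv /= lexx ltW.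
exists (connected_component D z).
  split; first by exists z => //; exact: subC.
  by move=> x Cx; move: Cz Cw zw; rewrite Cx /= => -> ->; rewrite ltxx.
move=> x Cx; rewrite /= in_itv /= !ltNge; apply/andP; split; apply/negP => le.
  by apply/Dp/subC/(intC _ _ Cx Cz); rewrite le ltW.
by apply/Dq/subC/(intC _ _ Cw Cx); rewrite le ltW.
Qed.

(** Only a right neighbourhood of the endpoint is described, so gaps unbounded above are covered
    too. *)
Lemma gap_inf D G : closed D -> gaps D G -> has_lbound G ->
  D (inf G) /\ exists2 v, inf G < v & forall x, inf G < x < v -> ~ D x.
Proof.
move=> clD [x0 Dx0 <-{G}]; set G := connected_component _ _ => lbG.
have Gx0 : G x0 by exact: connected_component_refl.
have subG : G `<=` ~` D := @connected_component_sub _ _ _.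
have /connected_intervalP intG : connected G := @component_connected _ _ _.
have hinf : has_inf G by split=> //; exists x0.
have above x : inf G < x -> x <= x0 -> G x.
  move=> Gx xx0; have x_gt0 : 0 < x - inf G by rewrite subr_gt0.
  have [g Gg] := inf_adherent x_gt0 hinf; rewrite subrKC => gx.
  by apply: intG Gg Gx0 _ _; rewrite xx0 andbT; exact: ltW.
have inf_x0 : inf G <= x0 by exact: ge_inf.
have Dinf : D (inf G).
  (* Were [inf G] outside the closed set [D], the component [G] would extend below its infimum. *)
  apply: contrapT => Dinf.
  have /open_nbhs_nbhs : open_nbhs (inf G) (~` D) by split => //; exact: closed_openC.
  move=> /nbhs_ballP[e /= e0 eP].
  have : `[inf G - e / 2, x0] `<=` G.
    apply: connected_component_max.
    - by rewrite /= in_itv /= lexx andbT; lra.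
    - move=> x; rewrite /= in_itv /= => /andP[ex xx0].
      have [xG|Gx] := leP x (inf G); last exact/subG/above.
      by apply: eP; rewrite /ball /= ltr_norml; apply/andP; split; lra.
    - exact/connected_intervalP/interval_is_interval.
  move=> /(_ (inf G - e / 2)); rewrite /= in_itv /= lexx /= => /(_ _)/(ge_inf lbG).
  lra.
split=> //; exists x0.
  by rewrite lt_neqAle inf_x0 andbT; apply/eqP => Gx; apply: Dx0; rewrite -Gx.
by move=> x /andP[Gx /ltW xx0]; exact/subG/above.
Qed.

Lemma gap_sup D G : closed D -> gaps D G -> has_ubound G ->
  D (sup G) /\ exists2 u, u < sup G & forall x, u < x < sup G -> ~ D x.
Proof.
move=> clD [x0 Dx0 <-{G}]; set G := connected_component _ _ => ubG.
have Gx0 : G x0 by exact: connected_component_refl.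
have subG : G `<=` ~` D := @connected_component_sub _ _ _.
have /connected_intervalP intG : connected G := @component_connected _ _ _.
have hsup : has_sup G by split=> //; exists x0.
have below x : x < sup G -> x0 <= x -> G x.
  move=> Gx xx0; have x_gt0 : 0 < sup G - x by rewrite subr_gt0.
  have [g Gg] := sup_adherent x_gt0 hsup; rewrite subKr => gx.
  by apply: intG Gx0 Gg _ _; rewrite xx0; exact: ltW.
have x0_sup : x0 <= sup G by exact: ub_le_sup.
have Dsup : D (sup G).
  apply: contrapT => Dsup.
  have /open_nbhs_nbhs : open_nbhs (sup G) (~` D) by split => //; exact: closed_openC.
  move=> /nbhs_ballP[e /= e0 eP].
  have : `[x0, sup G + e / 2] `<=` G.
    apply: connected_component_max.
    - by rewrite /= in_itv /= lexx; lra.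
    - move=> x; rewrite /= in_itv /= => /andP[xx0 ex].
      have [Gx|xG] := leP (sup G) x; last exact/subG/below.
      by apply: eP; rewrite /ball /= ltr_norml; apply/andP; split; lra.
    - exact/connected_intervalP/interval_is_interval.
  move=> /(_ (sup G + e / 2)); rewrite /= in_itv /= lexx andbT => /(_ _)/(ub_le_sup ubG).
  lra.
split=> //; exists x0.
  by rewrite lt_neqAle x0_sup andbT; apply/eqP => Gx; apply: Dx0; rewrite Gx.
by move=> x /andP[/ltW xx0 Gx]; exact/subG/below.
Qed.

End Gaps.

(** * An achievement set with an interval and infinitely many indices in K is a Cantorval *)

Section CantorvalCriterion.
Context {R : realType} (a : nat -> R).
Context (a_pos : forall n, (1 <= n)%N -> 0 < a n).
Context (a_decr : forall i j, (1 <= i)%N -> (i < j)%N -> a j < a i).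
Context (a_summable : cvgn (fun n => \sum_(1 <= i < n) a i)).

Local Notation r := (remainder a).
Local Notation E := (achievement_set a).

Lemma achievement_set_Cantorval (p q : R) :
    infinite_set [set n | (1 <= n)%N /\ r n < a n] ->
    p < q -> `[p, q] `<=` E ->
  Cantorval E.
Proof.
move=> infK pq pqE; split.
- by rewrite achievement_set_tail; exact: tail_sums_compact.
- exact: achievement_set_perfect.
have clE : closed E by rewrite achievement_set_tail; exact: tail_sums_closed.
move=> G x gapG [[lbG ->]|[ubG ->]].
- have [Ec [d cd cdE]] := gap_inf clE gapG lbG; set c := inf G in Ec cd cdE *.
  have near e := @near_gap_inf _ a a_pos a_summable a_decr c d e p q infK pq pqE cd Ec cdE.
  split=> U /nbhs_ballP[e /= e_gt0 eU];
      have [z [w [u [v [[cv vu uw wz zc] [wzE Eu Ev uvE]]]]]] := near _ e_gt0.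
    exists (`]v, u[%classic).
      split; first exact: gap_itv.
      move=> /= GE; have : G ((v + u) / 2) by rewrite -GE /= in_itv /=; lra.
      by move=> /(ge_inf lbG); rewrite -/c; lra.
    by move=> y; rewrite /= in_itv /= => yvu; apply: eU; rewrite /ball /= ltr_norml; lra.
  (* A component is trapped between the middle of the nearby gap and [c + m / 2], a point without
     sums on the other side of [c]; the choice of [m] keeps it within [e] of [c]. *)
  pose m := Num.min e (d - c).
  have m_gt0 : 0 < m by rewrite lt_min e_gt0 subr_gt0.
  have me : m <= e by rewrite ge_min lexx.
  have md : m <= d - c by rewrite ge_min lexx orbT.
  have [|||| C EC CU] := @nontrivial_component_within _ E ((v + u) / 2) w z (c + m / 2) _ _ _ wz _ wzE.
  + by apply: uvE; lra.
  + by apply: cdE; lra.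
  + by lra.
  + by lra.
  exists C => // y /CU; rewrite /= in_itv /= => yC.
  by apply: eU; rewrite /ball /= ltr_norml; lra.
- have [Ed [c cd cdE]] := gap_sup clE gapG ubG; set d := sup G in Ed cd cdE *.
  have near e := @near_gap_sup _ a a_pos a_summable a_decr c d e p q infK pq pqE cd Ed cdE.
  split=> U /nbhs_ballP[e /= e_gt0 eU];
      have [z [w [u [v [[dz zw wu uv vd] [zwE Eu Ev uvE]]]]]] := near _ e_gt0.
    exists (`]u, v[%classic).
      split; first exact: gap_itv.
      move=> /= GE; have : G ((u + v) / 2) by rewrite -GE /= in_itv /=; lra.
      by move=> /(ub_le_sup ubG); rewrite -/d; lra.
    by move=> y; rewrite /= in_itv /= => yuv; apply: eU; rewrite /ball /= ltr_norml; lra.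
  pose m := Num.min e (d - c).
  have m_gt0 : 0 < m by rewrite lt_min e_gt0 subr_gt0.
  have me : m <= e by rewrite ge_min lexx.
  have md : m <= d - c by rewrite ge_min lexx orbT.
  have [|||| C EC CU] := @nontrivial_component_within _ E (d - m / 2) z w ((u + v) / 2) _ _ _ zw _ zwE.
  + by apply: cdE; lra.
  + by apply: uvE; lra.
  + by lra.
  + by lra.
  exists C => // y /CU; rewrite /= in_itv /= => yC.
  by apply: eU; rewrite /ball /= ltr_norml; lra.
Qed.

End CantorvalCriterion.

(** * Chains of overlapping intervals and their refinement *)

Section Chains.
Context {R : realType} (a : nat -> R).
Context (a_pos : forall n, (1 <= n)%N -> 0 < a n).
Context (a_summable : cvgn (fun n => \sum_(1 <= i < n) a i)).

Local Notation r := (remainder a).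
Local Notation E := (achievement_set a).
Local Notation F := (finite_sums a).
Local Notation delta := (delta a).

(* A chain at level n is a list of intervals [z, z + r n], with z in F n, where
   each one starts before its predecessor ends; it need not be sorted. The
   list s contains the (signed) lengths of the overlaps between neighbours. *)
Inductive chain (n : nat) (s : seq R) (x : R) : R -> Prop :=
| chain_refl : F n x -> chain n s x x
| chain_rcons y z : chain n s x y -> F n z -> y + r n - z \in s -> chain n s x z.

Lemma chain_finite_sums n s x y : chain n s x y -> F n x /\ F n y.
Proof. by elim=> // {}y z _ [Fx _] Fz. Qed.

Lemma chain_trans n s x y z : chain n s x y -> chain n s y z -> chain n s x z.
Proof. by move=> xy; elim=> // u v _ xu Fv uv; exact: chain_rcons uv. Qed.

Lemma chain_edge n s x y : F n x -> F n y -> x + r n - y \in s -> chain n s x y.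
Proof. by move=> Fx Fy; apply: chain_rcons => //; exact: chain_refl. Qed.

(** With nonnegative overlaps, a point to the left of the last interval's start is not beyond the
    end of its predecessor, so the search goes back along the chain. *)
Lemma chain_cover n s x y p : {in s, forall M, 0 <= M} -> chain n s x y ->
  x <= p <= y + r n -> exists2 z, F n z & z <= p <= z + r n.
Proof.
move=> s0; elim=> [Fx|{}y z _ IH Fz /s0 yz] /andP[xp pz]; first by exists x; rewrite // xp.
have [zp|pz'] := leP z p; first by exists z; rewrite // zp.
by apply: IH; lra.
Qed.

(** [A z] and [B z] are the first and last intervals of a chain that replaces the interval at [z];
    each old overlap becomes a bridge from one such chain to the next. *)
Lemma chain_refine (A B : R -> R) n s n' s' x y :
    (forall z, F n z -> chain n' s' (A z) (B z)) ->
    (forall z w, F n z -> F n w -> z + r n - w \in s -> chain n' s' (B z) (A w)) ->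
  chain n s x y -> chain n' s' (A x) (B y).
Proof.
move=> AB BA; elim=> [/AB//|z w xz IH Fw zw].
have [_ Fz] := chain_finite_sums xz.
by apply: chain_trans IH (chain_trans (BA _ _ Fz Fw zw) (AB _ Fw)).
Qed.

(** The two halves of an interval overlap in [delta n.+1]. Overlaps of neighbours are unchanged,
    since the right half ends where the old interval ended. *)
Lemma chain_split n s x y : delta n.+1 \in s -> chain n s x y ->
  chain n.+1 s x (y + a n.+1).
Proof.
move=> ds; apply: (@chain_refine id (fun z => z + a n.+1)) => [z Fz|z w Fz Fw].
  apply: chain_edge; [exact: finite_sums_skip | exact: finite_sums_add |].
  by rewrite (_ : _ - _ = delta n.+1) // /Defs.delta; lra.
rewrite (remainderS a_pos a_summable n) addrA => zw.
by apply: chain_edge => //; [exact: finite_sums_add | exact: finite_sums_skip].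
Qed.

(** The difference [r n - r m] is the sum of the terms [n.+1] to [m], so the new end is the
    rightmost descendant of [y]. *)
Lemma chain_split_upto n m s x y : (n <= m)%N ->
    (forall i, (n < i <= m)%N -> delta i \in s) ->
  chain n s x y -> chain m s x (y + (r n - r m)).
Proof.
elim: m => [|m IH]; first by rewrite leqn0 => /eqP->; rewrite subrr addr0.
rewrite leq_eqVlt => /predU1P[-> _|]; first by rewrite subrr addr0.
rewrite ltnS => nm ds xy; rewrite (_ : _ + _ = y + (r n - r m) + a m.+1); last first.
  by rewrite (remainderS a_pos a_summable m); ring.
apply: chain_split; first by apply: ds; rewrite ltnS nm leqnn.
by apply: IH => // i /andP[ni im]; apply: ds; rewrite ni leqW.
Qed.

(* Goes alternately through the descendants of x and of y, in the lexicographic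
   order of their common digit words at the positions n+1, ..., m. *)
Lemma chain_interleave n m s x y : (n <= m)%N -> F n x -> F n y ->
    x + r m - y \in s ->
    (forall j, (n < j <= m)%N -> y - x + r j - a j \in s) ->
  chain m s x (y + (r n - r m)).
Proof.
(* Induction on the number of digits still to be chosen, with the final level [m] fixed. *)
move=> nm; rewrite -(subKn nm); move: (m - n)%N (leq_subr n m) => d.
elim: d x y => [|d IH] x y dm Fx Fy xy sP.
  by rewrite subn0 subrr addr0 in Fx Fy *; exact: chain_edge.
have mS : (m - d = (m - d.+1).+1)%N by lia.
have {}IH u v : F (m - d)%N u -> F (m - d)%N v -> v - u = y - x ->
    chain m s u (v + (r (m - d)%N - r m)).
  move=> Fu Fv uv; apply: IH (ltnW dm) Fu Fv _ _.
    have -> // : u + r m - v = x + r m - y.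
    by rewrite -[u](subKr v) uv; ring.
  by move=> j jm; rewrite uv; apply: sP; lia.
have rS : r (m - d.+1)%N = a (m - d)%N + r (m - d)%N.
  by rewrite mS -remainderS.
have FS z : F (m - d.+1)%N z -> F (m - d)%N z /\ F (m - d)%N (z + a (m - d)%N).
  by rewrite mS; split; [exact: finite_sums_skip | exact: finite_sums_add].
have [Fx0 Fx1] := FS _ Fx; have [Fy0 Fy1] := FS _ Fy.
have yx1 := IH _ _ Fx1 Fy1; have yx0 := IH _ _ Fx0 Fy0 erefl.
rewrite rS (_ : y + _ = y + a (m - d)%N + (r (m - d)%N - r m)); last by ring.
(* Descendants without the index [m - d] come first. The last of them, from [y], meets
   [x + a (m - d)] in an overlap listed in [s] by [sP] at [j = m - d]. *)
apply: chain_trans (yx1 _); last by ring.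
apply: chain_rcons yx0 _ _; first exact: finite_sums_widen (leq_subr d m) Fx1.
rewrite (_ : _ - _ = y - x + r (m - d)%N - a (m - d)%N); last by ring.
by apply: sP; lia.
Qed.

Lemma sum_shift k j : (0 < j)%N ->
  \sum_(1 <= l < j) a (k + l)%N = r k - r (k + j).-1.
Proof.
case: j => // j _; elim: j => [|j IH]; first by rewrite big_geq // addn1 subrr.
rewrite big_nat_recr //= IH !addnS /= (remainderS a_pos a_summable (k + j)).
by ring.
Qed.

(* Each z stands for the two siblings [z, z + r (k-1)] and
   [z + a (k-1), z + a (k-1) + r (k-1)]. Condition ( *' ) provides a chain from
   the descendant z + a k of the first one to the descendant
   z + a (k-1) + a (k+1) + ... + a (k+m-1) of the second one, and ( * ) or ( ** )
   links the latter to the entry point w + a k of the next pair. *)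
Lemma chain_star_step k m s s' x y : (1 < k)%N -> (0 < m)%N ->
    star_continues a k m s ->
    (forall M, M \in s -> {subset star_successors a k m M <= s'}) ->
    {subset lhs_star' a k m <= s'} ->
  chain k.-2 s x y ->
  chain (k + m).-1 s' (x + a k) (y + a k.-1 + (r k - r (k + m).-1)).
Proof.
case: k => [|[|k]] // _ m0 /andP[/allP sP _] ss' s's'; rewrite -!pred_Sn.
set e := (k.+2 + m).-1.
(* From here on the block runs from [k.+2] to [e]. *)
have r1 : r k.+1 = a k.+2 + r k.+2 := remainderS a_pos a_summable k.+1.
have r2 : r k = a k.+1 + r k.+1 := remainderS a_pos a_summable k.
have re j : (0 < j)%N -> r (k.+2 + j).-1 = a (k.+2 + j)%N + r (k.+2 + j)%N.
  by case: j => // j _; rewrite addnS; exact: remainderS.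
have F2 z : F k z -> F k.+1 z /\ F k.+1 (z + a k.+1).
  by split; [exact: finite_sums_skip | exact: finite_sums_add].
have F1 z : F k.+1 z -> F k.+2 z /\ F k.+2 (z + a k.+2).
  by split; [exact: finite_sums_skip | exact: finite_sums_add].
have ke : (k.+2 <= e)%N by rewrite /e; lia.
have idx j : (k.+2 < j)%N -> (j <= e)%N -> (j - k.+2)%N \in index_iota 1 m.
  by rewrite mem_index_iota /e; lia.
have inner z : F k z -> chain e s' (z + a k.+2) (z + a k.+1 + (r k.+2 - r e)).
  move=> /F2[/F1[_ Fz0] /F1[Fz1 _]]; apply: chain_interleave => //.
    apply: s's'; rewrite /lhs_star' inE sum_shift // -/e /Defs.delta r1.
    by apply/orP; left; apply/eqP; ring.
  move=> j /andP[kj je]; apply: s's'; rewrite inE; apply/orP; right.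
  apply/mapP; exists (j - k.+2)%N; first exact: idx.
  have jk : (0 < j - k.+2)%N by lia.
  by rewrite sum_shift // re // subnKC ?(ltnW kj) // /Defs.delta r1; ring.
apply: (@chain_refine (fun z => z + a k.+2) (fun z => z + a k.+1 + (r k.+2 - r e))) => //.
move=> z w Fz Fw zw; have [_ Fbz] := chain_finite_sums (inner _ Fz).
have [Faw _] := chain_finite_sums (inner _ Fw).
have [/F1[_ Fz10] /F1[Fz1 Fz11]] := F2 _ Fz; have [/F1[Fw00 _] _] := F2 _ Fw.
have zE : z + r k - w = z + a k.+1 + a k.+2 + r k.+2 - w by rewrite r2 r1; ring.
have := ss' _ zw; have := sP _ zw; rewrite /star_successors.
(* Under [lhs_star2] one edge suffices. Under [lhs_star] the path steps to [w], interleaves the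
   descendants of [w] and of [z + a k.+1 + a k.+2], and steps to [w + a k.+2]; both steps overlap by
   [M - a k.+2], where [M = z + r k - w]. *)
case: ifP => [_ _ sub|_ /= st sub]; last first.
  apply: chain_edge => //; apply: sub; rewrite st /= inE; apply/eqP.
  by rewrite zE; ring.
have sub1 M : M \in lhs_star a k.+2 m (z + r k - w) -> M \in s'.
  by move=> h; apply: sub; rewrite mem_cat h.
apply: (@chain_trans _ _ _ w).
  apply: chain_edge => //; first exact: finite_sums_widen ke Fw00.
  by apply: sub1; rewrite inE zE; apply/orP; left; apply/eqP; ring.
apply: (@chain_rcons _ _ _ (z + a k.+1 + a k.+2 + (r k.+2 - r e))) => //; last first.
  by apply: sub1; rewrite inE zE; apply/orP; left; apply/eqP; ring.
apply: chain_interleave => //.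
  by apply: sub1; rewrite !inE zE -/e; apply/or3P/Or32/eqP; ring.
move=> j /andP[kj je]; apply: sub1; rewrite !inE; apply/or3P/Or33.
apply/mapP; exists (j - k.+2)%N; first exact: idx.
have jk : (0 < j - k.+2)%N by lia.
by rewrite sum_shift // re // subnKC ?(ltnW kj) // zE; ring.
Qed.

End Chains.

(** * From the Star Procedure to an interval in the achievement set *)

Lemma min_natP (P : set nat) : (exists i, P i) -> P (min_nat P).
Proof.
move=> [i Pi]; have exP : exists i, `[< P i >] by exists i; apply/asboolP.
have [m /asboolP Pm mP] := ex_minnP exP.
have exM : exists i, P i /\ forall j, P j -> (i <= j)%N.
  by exists m; split=> // j /asboolP; exact: mP.
by case: (xgetPex 0%N exM).
Qed.

Lemma infinite_nat_gt (P : set nat) n : infinite_set P -> exists2 i, (n < i)%N & P i.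
Proof.
move=> infP; apply: contra_notP infP => nP.
apply: (sub_finite_set _ (finite_II n.+1)) => i Pi.
by rewrite /= ltnS leqNgt; apply/negP => ni; apply: nP; exists i.
Qed.

Section StarCantorval.
Context {R : realType} (a : nat -> R).
Context (a_pos : forall n, (1 <= n)%N -> 0 < a n).
Context (a_decr : forall i j, (1 <= i)%N -> (i < j)%N -> a j < a i).
Context (a_summable : cvgn (fun n => \sum_(1 <= i < n) a i)).
Context (inf_gt : infinite_set [set n | (1 <= n)%N /\ remainder a n < a n]).
Context (inf_lt : infinite_set [set n | (1 <= n)%N /\ a n < remainder a n]).
Context (a1_lt : a 1%N < remainder a 1).

Local Notation r := (remainder a).
Local Notation E := (achievement_set a).
Local Notation F := (finite_sums a).
Local Notation k := (idx_k a).
Local Notation m := (idx_m a).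

(** [inf_gt] and [inf_lt] make the sets being minimized nonempty, so the default value of [min_nat]
    is never taken. *)
Lemma idxP n : [/\ (k n + m n < k n.+1)%N, r (k n.+1) < a (k n.+1) & (0 < m n.+1)%N].
Proof.
rewrite /idx_k /idx_m /=; case: (block a n) => p q /=.
have exk : exists i, (p + q < i)%N /\ r i < a i.
  by have [i pqi [_ ri]] := infinite_nat_gt (p + q) inf_gt; exists i.
have [] := min_natP exk; set k' := min_nat _ => pq rk.
have exm : exists i, (0 < i)%N /\ a (k' + i)%N <= r (k' + i)%N.
  have [i ki [_ /ltW ai]] := infinite_nat_gt k' inf_lt; exists (i - k')%N.
  by split; [rewrite subn_gt0 | rewrite subnKC // ltnW].
by have [] := min_natP exm.
Qed.

Lemma k_lt n : (k n + m n < k n.+1)%N. Proof. by case: (idxP n). Qed.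

Lemma m_gt0 n : (0 < n)%N -> (0 < m n)%N.
Proof. by case: n => // n _; case: (idxP n). Qed.

(** [a1_lt] excludes the value 1 for the first index. Hence [(k n).-2] below is a true
    subtraction. *)
Lemma k_gt1 n : (0 < n)%N -> (1 < k n)%N.
Proof.
case: n => // n _; elim: n => [|n IH]; last first.
  by apply: leq_trans (k_lt n.+1); rewrite ltnW // ltnS (leq_trans IH) ?leq_addr.
have [k0 rk _] := idxP 0; rewrite ltn_neqAle (leq_ltn_trans _ k0) // andbT.
by apply/eqP => k1; move: rk; rewrite -k1 => /(lt_trans a1_lt); rewrite ltxx.
Qed.

Lemma k_ge n : (n <= k n)%N.
Proof.
elim: n => // n IH; apply: leq_ltn_trans IH (leq_ltn_trans _ (k_lt n)).
exact: leq_addr.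
Qed.

(** The length missing from [[0, r 0]] at each end of the chain of stage [n]. *)
Definition trim n : R := \sum_(1 <= i < n) a (k i).

Lemma trimS n : (0 < n)%N -> trim n.+1 = trim n + a (k n).
Proof. by move=> n0; rewrite /trim big_nat_recr. Qed.

(** The pairs of indices [(k i).-1], [k i] are disjoint, and in each the first term exceeds the
    second. The surplus of the first pair is kept as a margin independent of [n]. *)
Lemma trim_bound n :
  2 * trim n.+2 + (a (k 1).-1 - a (k 1)) <= fsubsum a (k n.+1) xpredT.
Proof.
have step p j : (p < j.-1)%N ->
    fsubsum a p xpredT + a j.-1 + a j <= fsubsum a j xpredT.
  case: j => [|[|j]] //=; rewrite ltnS => pj; rewrite !fsubsumS !lerD2r.
  have := remainder_split a_pos a_summable p; have := le_remainder a_pos a_summable pj.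
  rewrite (remainder_split a_pos a_summable j); lra.
elim: n => [|n IH].
  have := step 0%N (k 1); rewrite {1}/fsubsum big_geq // add0r trimS //.
  rewrite {1}/trim big_geq // add0r => /(_ _).
  have := k_gt1 (isT : (0 < 1)%N); case: (k 1) => [|[|j]] // _ /(_ isT) /=; lra.
rewrite trimS // mulrDr.
have k2 := k_gt1 (ltn0Sn n.+1); have k1 := k_gt1 (ltn0Sn n).
have lt_k : (k n.+1 < (k n.+2).-1)%N by have := k_lt n.+1; have := m_gt0 (ltn0Sn n); lia.
have := step _ _ lt_k.
have : a (k n.+2) < a (k n.+2).-1 by apply: a_decr; lia.
lra.
Qed.

(** The level stops at [(k n).-2] because the cut at [(k n).-1] is made together with the block that
    follows. *)
Lemma chain_star_sequence n s : star_sequence a n s -> (0 < n)%N /\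
  chain a (k n).-2 s (trim n) (r 0%N - trim n - r (k n).-2).
Proof.
elim=> [|{}n {}s _ [n_gt0 IH] cont]; split => //.
  rewrite /trim big_geq // subr0 -[r _ - _]add0r.
  apply: chain_split_upto => //; last first.
    by apply: chain_refl; exact: finite_sums0.
  move=> i /andP[i0 ik]; apply: map_f; rewrite mem_index_iota.
  have := k_gt1 (isT : (0 < 1)%N); lia.
set s' := flatten _ ++ _.
have kn := k_gt1 n_gt0; have mn := m_gt0 n_gt0; have kS := k_lt n.
have block_chain : chain a (k n + m n).-1 s' (trim n + a (k n))
    (r 0%N - trim n - r (k n).-2 + a (k n).-1 + (r (k n) - r (k n + m n).-1)).
  apply: (chain_star_step a_pos a_summable kn mn cont _ _ IH) => M.
    move=> Ms y y_in; rewrite mem_cat; apply/orP; left.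
    by apply/flatten_mapP; exists M.
  by move=> Ms; rewrite !mem_cat Ms orbT.
have r2 : r (k n).-2 = a (k n).-1 + (a (k n) + r (k n)).
  by case: (k n) kn => [|[|j]] // _; rewrite -remainderS // -remainderS.
rewrite trimS // (_ : _ - r (k n.+1).-2 =
  (r 0%N - trim n - r (k n).-2 + a (k n).-1 + (r (k n) - r (k n + m n).-1)) +
  (r (k n + m n).-1 - r (k n.+1).-2)); last by rewrite r2; ring.
apply: chain_split_upto block_chain => //; first by lia.
move=> i /andP[i1 i2]; rewrite !mem_cat; apply/orP; right; apply/orP; right.
by apply: map_f; rewrite mem_index_iota; lia.
Qed.

Lemma star_interval : star_never_breaks a ->
  exists p q : R, p < q /\ `[p, q] `<=` E.
Proof.
move=> star; pose eta := a (k 1).-1 - a (k 1).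
have k1 := k_gt1 (isT : (0 < 1)%N).
have eta_gt0 : 0 < eta by rewrite subr_gt0 a_decr //; lia.
(* By [trim_bound], this interval of length [eta] centred at half of [r 0] lies in the range of the
   chains used below. As [E] is closed, it suffices to approximate its points by finite sums. *)
exists ((r 0%N - eta) / 2), ((r 0%N + eta) / 2); split; first by lra.
have clE : closed E by rewrite achievement_set_tail; exact: tail_sums_closed.
move=> x; rewrite /= in_itv /= => xpq; rewrite (closure_id E).1 //.
move=> U /nbhs_ballP[e /= e_gt0 eU].
have [N NP] := remainder_lt_eps a_pos a_summable e_gt0.
(* Reaching one stage more shows that the procedure continues at stage [N.+2], which is what makes
   the entries of [s] positive. *)
have [s' st'] := star N.+3 isT.
have [s [st cont]] : exists s, star_sequence a N.+2 s /\
    star_continues a (k N.+2) (m N.+2) s.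
  by inversion st'; eexists; split; eassumption.
have [_ ch] := chain_star_sequence st.
have bound : 2 * trim N.+2 + eta <= r 0%N.
  apply: le_trans (trim_bound N) _.
  by rewrite (remainder_split a_pos a_summable (k N.+1)) lerDl remainder_ge0.
have pos_s : {in s, forall M, 0 <= M}.
  move=> M; case/andP: cont => /allP sP _ /sP.
  have ak : 0 < a (k N.+2) by apply: a_pos; exact: ltnW (k_gt1 _).
  by case/orP => /andP[+ _]; lra.
have [|z Fz xz] := chain_cover (p := x) pos_s ch; first by lra.
exists z; split; first exact: finite_sums_sub Fz.
have rN : r (k N.+2).-2 < e by apply: NP; have := k_ge N.+2; lia.
by apply: eU; rewrite /ball /= ltr_norml; lra.
Qed.

End StarCantorval.


Unset Implicit Arguments.
Set Strict Implicit.

Theorem theorem3p1 (R : realType) (a : nat -> R)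
  (a_pos : forall n, (1 <= n)%N -> 0 < a n)
  (a_decr : forall i j, (1 <= i)%N -> (i < j)%N -> a j < a i)
  (a_summable : cvgn (fun n => \sum_(1 <= i < n) a i))
  (inf_gt : infinite_set [set n | (1 <= n)%N /\ remainder a n < a n])
  (inf_lt : infinite_set [set n | (1 <= n)%N /\ a n < remainder a n])
  (a1_lt : a 1%N < remainder a 1)
  (star : star_never_breaks a) :
  Cantorval (achievement_set a).
Proof.
have [p [q [pq pqE]]] :=
  star_interval a_pos a_decr a_summable inf_gt inf_lt a1_lt star.
exact: (achievement_set_Cantorval a_pos a_decr a_summable inf_gt pq pqE).
Qed.
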